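(* Let $G$ be a graph. If $IC(G)=4$, then one of the following holds: $G\simeq K_4$; $G\simeq K_2+\overline{K}_n$ for some $n\ge 2$; $G\simeq K_1+B$ for some $B\in\mathcal{B}_2$; $G\in\mathcal{B}_1$; or $G\in\mathcal{B}_3$.
   Context: Graphs are finite and simple with nonempty vertex set. $K_n$ is the complete graph of order $n$, $\overline{K}_m$ is the edgeless graph of order $m$, $\delta(H)$ is the minimum degree of $H$, $\cup$ between graphs denotes disjoint union, and the join $G+H$ of two disjoint graphs is obtained from their union by adding all edges between vertices of $G$ and vertices of $H$. A set $S$ of vertices is dominating if every vertex is in $S$ or adjacent to a vertex of $S$; it is independent if its vertices are pairwise nonadjacent; an independent dominating set is a set that is both independent and dominating. An idomatic partition of a graph is a partition of its vertex set into independent dominating sets; the idomatic number $id(H)$ is the maximum number of classes of an idomatic partition of $H$. Families of graphs (up to isomorphism): $\mathcal{B}_1$ is the family of bipartite graphs $H$ with partite sets $H_1,H_2$ such that $|H_1|\ge 2$, $|H_2|\ge 2$, $\delta(H)\ge 1$ and $id(H)=2$; $\mathcal{B}_2$ is the family of graphs $H\cup\overline{K}_m$, where $m\ge 1$ and $H$ is a bipartite graph with $\delta(H)\ge 1$ and $id(H)=2$; $\mathcal{B}_3$ is the family of graphs $H\cup\overline{K}_m$, where $m\ge 1$ and $H$ is a $3$-partite graph with $\delta(H)\ge 1$ and $id(H)=3$. An independent coalition in $G$ consists of two disjoint independent sets of vertices $V_1,V_2$, neither of which is an independent dominating set but whose union $V_1\cup V_2$ is an independent dominating set; one says that $V_1$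 and $V_2$ form an independent coalition. An $ic$-partition of $G$ is a partition $\pi=\{V_1,\dots,V_k\}$ of $V(G)$ into nonempty sets such that every $V_i\in\pi$ either is a singleton dominating set (a dominating set of cardinality 1), or is not an independent dominating set but forms an independent coalition with another set $V_j\in\pi$. The independent coalition number $IC(G)$ is the maximum number of classes of an $ic$-partition of $G$; the assertion $IC(G)=t$ includes that $G$ has an $ic$-partition. *)

(* Defs.v *)
From mathcomp Require Import all_boot.

Set Implicit Arguments.
Unset Strict Implicit.
Unset Printing Implicit Defensive.

(* Nonemptiness of the vertex set is not a field: it is assumed explicitly
   wherever it does not follow from other conditions, so that ['I_n] can be used as a vertex
   type for every [n]. *)
Record sgraph := SGraph {
  vertex :> finType;
  adj : rel vertex;
  adj_sym : symmetric adj;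
  adj_irrefl : irreflexive adj
}.

Definition isomorphic (G H : sgraph) : Prop :=
  exists2 f : G -> H, bijective f & forall x y, adj (f x) (f y) = adj x y.

Definition complete_rel (n : nat) : rel 'I_n := fun x y => x != y.

Lemma complete_sym n : symmetric (@complete_rel n).
Proof. by move=> x y; rewrite /complete_rel eq_sym. Qed.

Lemma complete_irrefl n : irreflexive (@complete_rel n).
Proof. by move=> x; rewrite /complete_rel eqxx. Qed.

Definition complete (n : nat) : sgraph :=
  SGraph (@complete_sym n) (@complete_irrefl n).

Definition edgeless_rel (n : nat) : rel 'I_n := fun _ _ => false.

Lemma edgeless_sym n : symmetric (@edgeless_rel n).
Proof. by []. Qed.

Lemma edgeless_irrefl n : irreflexive (@edgeless_rel n).
Proof. by []. Qed.

Definition edgeless (n : nat) : sgraph :=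
  SGraph (@edgeless_sym n) (@edgeless_irrefl n).

(* Vertices from different summands are adjacent iff [b]: [b = false] is the
   disjoint union and [b = true] is the join. *)
Definition sum_rel (b : bool) (G H : sgraph) : rel (G + H) := fun u v =>
  match u, v with
  | inl x, inl y => adj x y
  | inr x, inr y => adj x y
  | _, _ => b
  end.

Lemma sum_rel_sym b G H : symmetric (@sum_rel b G H).
Proof. by case=> x [] y //=; rewrite adj_sym. Qed.

Lemma sum_rel_irrefl b G H : irreflexive (@sum_rel b G H).
Proof. by case=> x /=; rewrite adj_irrefl. Qed.

Definition disjoint_union (G H : sgraph) : sgraph :=
  SGraph (@sum_rel_sym false G H) (@sum_rel_irrefl false G H).

Definition join (G H : sgraph) : sgraph :=
  SGraph (@sum_rel_sym true G H) (@sum_rel_irrefl true G H).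

Definition degree (G : sgraph) (v : G) : nat := #|[set w | adj v w]|.

(* Every degree is smaller than #|G|, so on a nonempty graph the default value
   #|G| never is the minimum. *)
Definition min_degree (G : sgraph) : nat := \big[minn/#|G|]_(v : G) degree v.

Definition dominating (G : sgraph) (S : {set G}) : bool :=
  [forall v, (v \in S) || [exists u in S, adj v u]].

Definition independent (G : sgraph) (S : {set G}) : bool :=
  [forall u in S, forall v in S, ~~ adj u v].

Definition indep_dominating (G : sgraph) (S : {set G}) : bool :=
  independent S && dominating S.

Definition idomatic_partition (G : sgraph) (P : {set {set G}}) : bool :=
  partition P [set: G] && [forall A in P, indep_dominating A].

(* The maximum over an empty range is 0, while every partition of a nonempty
   graph has a class; hence, for k > 0, [idomatic_number = k] (and likewise
   [IC = k] below) includes the existence of a suitable partition. *)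
Definition idomatic_number (G : sgraph) : nat :=
  \max_(P : {set {set G}} | idomatic_partition P) #|P|.

Definition indep_coalition (G : sgraph) (A B : {set G}) : bool :=
  [&& [disjoint A & B], independent A, independent B,
      ~~ indep_dominating A, ~~ indep_dominating B
    & indep_dominating (A :|: B)].

Definition singleton_dominating (G : sgraph) (A : {set G}) : bool :=
  (#|A| == 1) && dominating A.

Definition ic_partition (G : sgraph) (P : {set {set G}}) : bool :=
  partition P [set: G] &&
  [forall A in P, singleton_dominating A ||
     (~~ indep_dominating A &&
      [exists B in P, (B != A) && indep_coalition A B])].

Definition IC (G : sgraph) : nat :=
  \max_(P : {set {set G}} | ic_partition P) #|P|.

(* Partite sets are allowed to be empty, as usual for k-partite graphs. *)
Definition partite_sets (G : sgraph) (k : nat) (V : 'I_k -> {set G}) : Prop :=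
  [/\ \bigcup_i V i = [set: G],
      forall i j, i != j -> [disjoint V i & V j]
    & forall i, independent (V i)].

Definition multipartite (G : sgraph) (k : nat) : Prop :=
  exists V : 'I_k -> {set G}, partite_sets V.

Definition family_B1 (H : sgraph) : Prop :=
  [/\ exists2 V : 'I_2 -> {set H}, partite_sets V & forall i, 2 <= #|V i|,
      1 <= min_degree H
    & idomatic_number H = 2].

Definition family_B2 (G : sgraph) : Prop :=
  exists (H : sgraph) (m : nat),
    [/\ 0 < #|H|, 1 <= m,
        [/\ multipartite H 2, 1 <= min_degree H & idomatic_number H = 2]
      & isomorphic G (disjoint_union H (edgeless m))].

Definition family_B3 (G : sgraph) : Prop :=
  exists (H : sgraph) (m : nat),
    [/\ 0 < #|H|, 1 <= m,
        [/\ multipartite H 3, 1 <= min_degree H & idomatic_number H = 3]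
      & isomorphic G (disjoint_union H (edgeless m))].

(* Main.v *)
Require Import Defs.
From mathcomp Require Import all_boot.

Set Implicit Arguments.
Unset Strict Implicit.
Unset Printing Implicit Defensive.

(** Let P be an ic-partition of G with four classes. A vertex adjacent to all
    others lies in no larger independent set, so each such universal vertex is
    a class of its own ([universal_class]). The classes that remain form a
    partition Q of the set S of non-universal vertices, and coalition partners
    of members of Q are again in Q ([ic_partition_split]). Hence
    #|universal G| + #|Q| = 4, and the proof goes by the size of Q.

    - #|Q| = 0: every vertex is universal and G is K_4.
    - #|Q| = 1 cannot occur, because the class would have no partner.
    - #|Q| = 2: the two classes are partners, so S is independent and G is the
      join of K_2 with an edgeless graph.
    - #|Q| = 3 or 4: the partnership relation has no isolated point, so either
      some class A is a partner of all the others, or #|Q| = 4 and Q splits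
      into two pairs of partners ([star_or_matching]).

    In the star case no edge joins A to the set of vertices of the other
    classes, so on S the graph is the disjoint union of the graph H induced on
    that set and of the edgeless graph on A. Adding A turns the independent
    dominating sets of H into those of G that avoid the universal vertices
    ([indep_dominating_lift]). Thus the other classes form an idomatic
    partition of H. Conversely, any idomatic partition of H, together with A
    and the universal singletons, is an ic-partition of G
    ([idomatic_partition_leq_IC]), so maximality of IC(G) gives
    id(H) = #|Q| - 1. This yields the join with a member of B_2 when #|Q| = 3
    and a member of B_3 when #|Q| = 4.

    In the matching case G has no universal vertex, and the unions of the two
    pairs form an idomatic partition, so G is bipartite. Cutting every class of
    an idomatic partition in two gives an ic-partition with twice as many
    classes ([double_idomatic_leq_IC]), so id(G) = 2 and G is in B_1. *)

(** * Maxima and partitions *)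

Lemma bigmax_witness (I : finType) (p : pred I) (F : I -> nat) (k : nat) :
  0 < k -> \max_(i | p i) F i = k -> exists2 i, p i & F i = k.
Proof.
move=> k_gt0 maxF; have [i0 pi0|p0] := pickP p.
  rewrite (bigmax_eq_arg i0) // in maxF.
  by move: maxF; case: arg_maxnP => // i pi _ Fi; exists i.
by move: k_gt0; rewrite -maxF big_pred0.
Qed.

Lemma partition_mem_inj (T : finType) (P : {set {set T}}) (D A B : {set T}) x :
  partition P D -> A \in P -> B \in P -> x \in A -> x \in B -> A = B.
Proof.
move=> /partition_trivIset tiP AP BP Ax Bx.
by rewrite -(def_pblock tiP AP Ax) (def_pblock tiP BP Bx).
Qed.

(** * Independent dominating sets and coalitions *)

Lemma independentP (G : sgraph) (S : {set G}) :
  reflect {in S &, forall u v, ~~ adj u v} (independent S).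
Proof.
apply: (iffP forall_inP) => [h u v Su Sv|h u Su].
  exact: (forall_inP (h u Su)).
by apply/forall_inP => v; apply: h.
Qed.

Lemma dominatingP (G : sgraph) (S : {set G}) :
  reflect (forall v, v \in S \/ exists2 u, u \in S & adj v u) (dominating S).
Proof.
apply: (iffP forallP) => h v.
  by case/orP: (h v) => [|/exists_inP]; [left | right].
by case: (h v) => [->|/exists_inP ->]; rewrite ?orbT.
Qed.

Lemma independentS (G : sgraph) (A B : {set G}) :
  A \subset B -> independent B -> independent A.
Proof.
move=> /subsetP sAB /independentP indB; apply/independentP => u v Au Av.
by apply: indB; apply: sAB.
Qed.

Lemma independent1 (G : sgraph) (x : G) : independent [set x].
Proof. by apply/independentP => u v /set1P-> /set1P->; rewrite adj_irrefl. Qed.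

(** A vertex of [B] outside [A] would have a neighbour in [A], hence in [B]:
    independent dominating sets are maximal independent sets. *)
Lemma indep_dominating_max (G : sgraph) (A B : {set G}) :
  indep_dominating A -> A \subset B -> independent B -> A = B.
Proof.
case/andP=> _ /dominatingP domA sAB /independentP indB.
apply/eqP; rewrite eqEsubset sAB; apply/subsetP => v Bv.
case: (domA v) => // -[u Au vu].
by case/negP: (indB v u Bv (subsetP sAB u Au)).
Qed.

Lemma indep_dominating_neq0 (G : sgraph) (A : {set G}) :
  0 < #|G| -> indep_dominating A -> A != set0.
Proof.
case/card_gt0P=> x _ /andP[_ /dominatingP/(_ x) domx].
by apply/set0Pn; case: domx => [|[u]]; [exists x | exists u].
Qed.

(** By maximality a proper subset of an independent dominating set is never
    dominating, so only the union has to be tested. *)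
Lemma indep_coalition_disjoint (G : sgraph) (A B : {set G}) :
  A != set0 -> B != set0 -> [disjoint A & B] ->
  indep_coalition A B = indep_dominating (A :|: B).
Proof.
move=> A0 B0 dAB; apply/idP/idP => [/and5P[_ _ _ _ /andP[]] //|idAB].
have indAB : independent (A :|: B) by case/andP: idAB.
have proper (X Y : {set G}) : Y != set0 -> [disjoint X & Y] ->
    independent (X :|: Y) -> ~~ indep_dominating X.
  case/set0Pn=> y Yy dXY indXY; apply/negP => idX.
  have eqX := indep_dominating_max idX (subsetUl X Y) indXY.
  by move: (disjointFl dXY Yy); rewrite eqX inE Yy orbT.
rewrite /indep_coalition dAB idAB (independentS (subsetUl A B)) //.
rewrite (independentS (subsetUr A B)) // (proper A B) //.
by rewrite (proper B A) // ?[_ :|: A]setUC // disjoint_sym.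
Qed.

(** A class with a partner is a proper subset of an independent dominating set,
    so the clause that it is not one itself follows from the existence of the
    partner. *)
Lemma ic_partitionP (G : sgraph) (P : {set {set G}}) :
  partition P [set: G] ->
  reflect {in P, forall A, singleton_dominating A \/
             exists2 B, B \in P & (B != A) && indep_dominating (A :|: B)}
          (ic_partition P).
Proof.
move=> partP; rewrite /ic_partition partP /=.
have coalE A B : A \in P -> B \in P -> B != A ->
    indep_coalition A B = indep_dominating (A :|: B).
  move=> AP BP neqBA; apply: indep_coalition_disjoint; try exact: partition_neq0 partP _.
  by apply: (trivIsetP (partition_trivIset partP)); rewrite // eq_sym.
apply: (iffP forall_inP) => icP A AP.
  case/orP: (icP A AP) => [|/andP[_ /exists_inP[B BP /andP[nBA coalAB]]]].
    by left.
  by right; exists B; rewrite // nBA -coalE.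
case: (icP A AP) => [->//|[B BP /andP[nBA idAB]]]; apply/orP; right.
have coalAB : indep_coalition A B by rewrite coalE.
have [_ _ _ nidA _] := and5P coalAB.
by rewrite nidA; apply/exists_inP; exists B; rewrite ?nBA.
Qed.

Lemma ic_class_independent (G : sgraph) (P : {set {set G}}) (A : {set G}) :
  ic_partition P -> A \in P -> independent A.
Proof.
case/andP=> _ /forall_inP icP AP; case/orP: (icP A AP).
  by case/andP=> /cards1P[x ->] _; apply: independent1.
by case/andP=> _ /exists_inP[B _ /andP[_ /and3P[]]].
Qed.

(** * Universal vertices *)

Definition universal (G : sgraph) : {set G} := [set x | dominating [set x]].

Lemma universalP (G : sgraph) (x y : G) :
  x \in universal G -> x != y -> adj x y.
Proof.
rewrite inE => /dominatingP/(_ y)[/set1P->|[u /set1P-> yx] _].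
  by rewrite eqxx.
by rewrite adj_sym.
Qed.

Lemma universal_indep_dominating (G : sgraph) (x : G) :
  x \in universal G -> indep_dominating [set x].
Proof. by rewrite inE /indep_dominating independent1. Qed.

Definition universal_classes (G : sgraph) : {set {set G}} :=
  [set [set x] | x in universal G].

Lemma card_universal_classes (G : sgraph) :
  #|universal_classes G| = #|universal G|.
Proof. exact/card_imset/set1_inj. Qed.

Lemma universal_classesP (G : sgraph) (A : {set G}) :
  (A \in universal_classes G) = singleton_dominating A.
Proof.
apply/imsetP/andP => [[x xU ->]|[/cards1P[x ->] domx]].
  by rewrite cards1; move: xU; rewrite inE.
by exists x; rewrite ?inE.
Qed.

(** The class of [x] is independent and contains the maximal independent set
    [[set x]]. *)
Lemma universal_class (G : sgraph) (P : {set {set G}}) (x : G) :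
  ic_partition P -> x \in universal G -> [set x] \in P.
Proof.
move=> icP xU; have /andP[partP _] := icP.
have xP : x \in cover P by rewrite (cover_partition partP).
rewrite (@indep_dominating_max _ [set x] (pblock P x)) ?pblock_mem //.
- exact: universal_indep_dominating.
- by rewrite sub1set mem_pblock.
- by apply: ic_class_independent icP _; rewrite pblock_mem.
Qed.

(** The universal singletons can be removed from an ic-partition without
    breaking any coalition: such a singleton is already maximal independent, so
    it cannot be half of one. *)
Lemma ic_partition_split (G : sgraph) (P : {set {set G}}) :
  ic_partition P -> exists Q : {set {set G}},
    [/\ partition Q (~: universal G), #|P| = #|universal G| + #|Q|
      & {in Q, forall A, exists2 B, B \in Q &
           (B != A) && indep_dominating (A :|: B)}].
Proof.
move=> icP; have /andP[partP _] := icP.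
have sUP : universal_classes G \subset P.
  by apply/subsetP => _ /imsetP[x xU ->]; apply: universal_class.
exists (P :\: universal_classes G); split.
- have := partP; rewrite /partition => /and3P[_ tiP P0].
  apply/and3P; split; [|exact: trivIsetD|by rewrite inE (negPf P0) andbF].
  apply/eqP/setP => x; rewrite [RHS]inE; apply/bigcupP/idP => [[A]|xU].
    rewrite inE => /andP[AU AP] Ax; apply: contra AU => xU.
    rewrite -(partition_mem_inj partP (universal_class icP xU) AP _ Ax) ?inE //.
    exact: imset_f.
  have xP : x \in cover P by rewrite (cover_partition partP).
  exists (pblock P x); rewrite ?mem_pblock // inE pblock_mem // andbT.
  apply: contra xU => /imsetP[y yU eqy].
  by move: xP; rewrite -mem_pblock eqy => /set1P->.
- by rewrite -card_universal_classes cardsD (setIidPr sUP) subnKC ?subset_leq_card.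
move=> A; rewrite inE => /andP[AU AP].
have [/idP|[B BP /andP[nBA idAB]]] := ic_partitionP partP icP A AP.
  by rewrite -universal_classesP (negPf AU).
exists B; rewrite ?nBA // inE BP andbT; apply/imsetP => -[x xU eqB].
have eqBAB : B = A :|: B.
  apply: indep_dominating_max; rewrite ?subsetUr //.
    by rewrite eqB universal_indep_dominating.
  by case/andP: idAB.
have /set0Pn[a Aa] := partition_neq0 partP AP.
have Ba : a \in B by rewrite eqBAB inE Aa.
by case/eqP: nBA; apply: (partition_mem_inj partP BP AP Ba Aa).
Qed.

(** * Consequences of an idomatic partition *)

Lemma idomatic_multipartite (G : sgraph) (P : {set {set G}}) :
  idomatic_partition P ->
  exists2 V : 'I_#|P| -> {set G}, partite_sets V & forall i, V i \in P.
Proof.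
case/andP=> partP /forall_inP idP.
exists (fun i => enum_val i) => [|i]; last exact: enum_valP.
split=> [|i j nij|i].
- apply/setP => x; rewrite inE; apply/bigcupP.
  have : x \in cover P by rewrite (cover_partition partP).
  case/bigcupP=> A AP Ax; exists (enum_rank_in AP A) => //.
  by rewrite enum_rankK_in.
- apply: (trivIsetP (partition_trivIset partP)); rewrite ?enum_valP //.
  by rewrite (inj_eq enum_val_inj).
- by have /andP[] := idP _ (enum_valP i).
Qed.

Lemma min_degree_gt0 (G : sgraph) :
  0 < #|G| -> (forall v : G, exists w, adj v w) -> 0 < min_degree G.
Proof.
move=> G_gt0 nbr; rewrite /min_degree; elim/big_ind: _ => // [m n|v _].
  by rewrite leq_min => ->.
by have [w vw] := nbr v; apply/card_gt0P; exists w; rewrite inE.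
Qed.

(** Each vertex is dominated by a class other than its own. *)
Lemma idomatic_min_degree (G : sgraph) (P : {set {set G}}) :
  0 < #|G| -> idomatic_partition P -> 1 < #|P| -> 0 < min_degree G.
Proof.
move=> G_gt0 /andP[partP /forall_inP idP] P_gt1; apply: min_degree_gt0 => // v.
have vP : v \in cover P by rewrite (cover_partition partP).
have : 0 < #|P :\ pblock P v|.
  by move: P_gt1; rewrite (cardsD1 (pblock P v)) pblock_mem.
case/card_gt0P=> A; rewrite !inE => /andP[nA AP].
have /andP[_ /dominatingP/(_ v)[Av|[u _ vu]]] := idP A AP; last by exists u.
by case/eqP: nA; rewrite (def_pblock (partition_trivIset partP) AP Av).
Qed.

Lemma leq_idomatic_number (G : sgraph) (P : {set {set G}}) :
  idomatic_partition P -> #|P| <= idomatic_number G.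
Proof. exact: (leq_bigmax_cond (F := fun P : {set {set G}} => #|P|)). Qed.

Lemma leq_IC (G : sgraph) (P : {set {set G}}) : ic_partition P -> #|P| <= IC G.
Proof. exact: (leq_bigmax_cond (F := fun P : {set {set G}} => #|P|)). Qed.

(** Without universal vertices each independent dominating set has at least two
    elements, so it can be cut into a marked singleton and the nonempty rest;
    these two halves form an independent coalition. *)
Lemma double_idomatic_leq_IC (G : sgraph) :
  0 < #|G| -> universal G = set0 -> idomatic_number G * 2 <= IC G.
Proof.
move=> G_gt0 U0; have [->//|id_gt0] := posnP (idomatic_number G).
have [P idomP <-] := bigmax_witness id_gt0 erefl.
have /andP[partP /forall_inP idP] := idomP.
pose mark (A : {set G}) := if [pick x in A] is Some x then [set x] else set0.
pose half (p : {set G} * bool) := [set x in p.1 | (x \in mark p.1) == p.2].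
have halfU A b : half (A, b) :|: half (A, ~~ b) = A.
  by apply/setP => x; rewrite !inE -andb_orr; case: (x \in mark A);
     case: b; rewrite andbT.
have half0 p : p \in setX P [set: bool] -> half p != set0.
  case: p => A b; rewrite !inE andbT => /= AP.
  have [x Ax] := set0Pn _ (indep_dominating_neq0 G_gt0 (idP A AP)).
  have markE : exists2 y, y \in A & mark A = [set y].
    rewrite /mark; case: pickP => [y Ay|/(_ x)]; last by rewrite Ax.
    by exists y.
  case: markE => y Ay markA; case: b.
    by apply/set0Pn; exists y; rewrite !inE Ay markA set11.
  apply/negP => /eqP half0.
  have : [set y] = A.
    apply/eqP; rewrite eqEsubset sub1set Ay; apply/subsetP => z Az.
    by move/setP/(_ z): half0; rewrite !inE Az markA inE; case: (z == y).
  (* If nothing is left over, the marked vertex is universal. *)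
  move=> eqA; have := idP A AP; rewrite -eqA => /andP[_ domy].
  by have := in_set0 y; rewrite -U0 inE domy.
have halfI p q x : p \in setX P [set: bool] -> q \in setX P [set: bool] ->
    x \in half p -> x \in half q -> p = q.
  case: p q => [A b] [B c]; rewrite !inE !andbT /= => AP BP /andP[Ax /eqP <-].
  case/andP=> Bx /eqP <-.
  by rewrite (partition_mem_inj partP AP BP Ax Bx).
have disj : {in setX P [set: bool] &, forall p q, q != p -> [disjoint half p & half q]}.
  move=> p q pP qP; apply: contraR => /pred0Pn[x /= /andP[px qx]].
  by rewrite (halfI p q x).
have [partQ injh] := indexed_partition disj half0.
set Q := [set half p | p in _] in partQ.
have covQ : cover Q = [set: G].
  apply/setP => x; rewrite inE; apply/bigcupP.
  have xP : x \in cover P by rewrite (cover_partition partP).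
  exists (half (pblock P x, x \in mark (pblock P x))).
    by apply: imset_f; rewrite !inE pblock_mem.
  by rewrite inE mem_pblock xP eqxx.
rewrite covQ in partQ.
have -> : #|P| * 2 = #|Q|.
  by rewrite card_in_imset // cardsX cardsT card_bool.
apply: leq_IC; apply/(ic_partitionP partQ) => _ /imsetP[[A b] ABP ->]; right.
have ABP' : (A, ~~ b) \in setX P [set: bool] by move: ABP; rewrite !inE.
exists (half (A, ~~ b)); first exact: imset_f.
rewrite halfU idP; last by move: ABP; rewrite !inE andbT.
rewrite andbT; apply/negP => /eqP/(injh _ _ ABP' ABP) [].
by case: b {ABP ABP'}.
Qed.

(** * Induced subgraphs *)

Section Induced.

Variables (G : sgraph) (S : {set G}).

Definition induced_rel : rel {x | x \in S} := fun x y => adj (val x) (val y).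

Lemma induced_sym : symmetric induced_rel.
Proof. by move=> x y; apply: adj_sym. Qed.

Lemma induced_irrefl : irreflexive induced_rel.
Proof. by move=> x; apply: adj_irrefl. Qed.

Definition induced : sgraph := SGraph induced_sym induced_irrefl.

Lemma card_induced : #|induced| = #|S|.
Proof. exact: card_sig. Qed.

Definition lift_set (X : {set induced}) : {set G} := val @: X.

Lemma mem_lift_set X (x : induced) : (val x \in lift_set X) = (x \in X).
Proof. exact/mem_imset/val_inj. Qed.

Lemma lift_set_inj : injective lift_set.
Proof. exact/imset_inj/val_inj. Qed.

Lemma lift_setS X : lift_set X \subset S.
Proof. by apply/subsetP => _ /imsetP[x _ ->]; apply: valP. Qed.

Lemma lift_setT : lift_set [set: induced] = S.
Proof.
apply/setP => x; apply/idP/idP => [|Sx]; first exact: (subsetP (lift_setS _)).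
by rewrite -[x]/(val (Sub x Sx : induced)) mem_lift_set inE.
Qed.

Lemma lift_partition (D : {set {set induced}}) :
  partition [set lift_set X | X in D] S = partition D [set: induced].
Proof. by rewrite -{1}lift_setT; apply/imset_partition/val_inj. Qed.

Lemma lift_setK (B : {set G}) :
  B \subset S -> lift_set [set x : induced | val x \in B] = B.
Proof.
move=> sBS; apply/setP => x; apply/idP/idP => [/imsetP[y]|Bx].
  by rewrite inE => ? ->.
by rewrite -[x]/(val (Sub x (subsetP sBS x Bx) : induced)) mem_lift_set inE.
Qed.

End Induced.

(** * An independent set of vertices isolated among the non-universal ones *)

Section IsolatedClass.

Variables (G : sgraph) (A S : {set G}).
Hypotheses (A0 : A != set0) (S0 : S != set0) (dAS : [disjoint A & S]).
Hypotheses (covAS : A :|: S = ~: universal G) (indA : independent A).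
Hypothesis noAS : forall a s, a \in A -> s \in S -> ~~ adj a s.

(** Vertices of [S] can only be dominated from within [S], while [A], being
    nonempty, dominates itself and the universal vertices. *)
Lemma indep_dominating_lift (X : {set induced S}) :
  indep_dominating (A :|: lift_set X) = indep_dominating X.
Proof.
apply/andP/andP => -[/independentP ind /dominatingP dom]; split.
- apply/independentP => u v Xu Xv.
  by apply: (ind (val u) (val v)); rewrite inE mem_lift_set ?Xu ?Xv orbT.
- apply/dominatingP => v; have [] := dom (val v).
    by rewrite inE (disjointFl dAS (valP v)) mem_lift_set; left.
  case=> u; rewrite inE => /orP[Au|/imsetP[w Xw ->] vw]; last by right; exists w.
  by rewrite adj_sym (negPf (noAS Au (valP v))).
- have noAX a x : a \in A -> x \in lift_set X -> ~~ adj a x.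
    by move=> Aa /(subsetP (lift_setS X)); apply: noAS.
  apply/independentP => u v /setUP[Au|Xu] /setUP[Av|Xv].
  + exact: (independentP _ indA u v Au Av).
  + exact: noAX.
  + by rewrite adj_sym noAX.
  + by case/imsetP: Xu Xv => x Xx -> /imsetP[y Xy ->]; apply: ind.
- apply/dominatingP => v; have [vU|vU] := boolP (v \in universal G).
    have [a Aa] := set0Pn _ A0; right; exists a; first by rewrite inE Aa.
    apply: universalP => //; apply: contraTneq Aa => <-.
    have : v \notin A :|: S by rewrite covAS inE vU.
    by rewrite inE negb_or => /andP[].
  have : v \in A :|: S by rewrite covAS inE.
  case/setUP=> [Av|Sv]; first by left; rewrite inE Av.
  have [Xv|[u Xu vu]] := dom (Sub v Sv : induced S).
    by left; rewrite inE -[v]/(val (Sub v Sv : induced S)) mem_lift_set Xv orbT.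
  by right; exists (val u); rewrite // inE mem_lift_set Xu orbT.
Qed.

Lemma idomatic_partition_lift (R : {set {set G}}) :
  partition R S -> {in R, forall B, indep_dominating (A :|: B)} ->
  exists2 D : {set {set induced S}}, idomatic_partition D & #|D| = #|R|.
Proof.
move=> partR idR.
pose D := [set [set x : induced S | val x \in B] | B : {set G} in R].
have liftK B : B \in R -> lift_set [set x : induced S | val x \in B] = B.
  by move=> BR; apply/lift_setK/(partitionS partR).
have RE : [set lift_set X | X in D] = R.
  rewrite -imset_comp -[RHS]imset_id; apply: eq_in_imset => B BR.
  exact: liftK.
exists D.
  apply/andP; split; first by rewrite -lift_partition RE.
  apply/forall_inP => _ /imsetP[B BR ->].
  by rewrite -indep_dominating_lift liftK ?idR.
by rewrite -RE (card_imset _ (@lift_set_inj G S)).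
Qed.

(** The ic-partition consists of the universal singletons, [A] and the classes
    of [D]; by [indep_dominating_lift] each class of [D] is a partner of
    [A]. *)
Lemma idomatic_partition_leq_IC (D : {set {set induced S}}) :
  idomatic_partition D -> #|universal G| + #|D|.+1 <= IC G.
Proof.
case/andP=> partD /forall_inP idD.
pose L := [set lift_set X | X in D].
have partL : partition L S by rewrite lift_partition.
have cardL : #|L| = #|D| by rewrite card_imset //; apply: lift_set_inj.
have AL : A \notin L.
  apply: contra A0 => AL; have := partitionS partL AL.
  by move=> /(disjointWr)/(_ dAS); rewrite -setI_eq0 setIid.
have partAL : partition (A |: L) (~: universal G).
  by rewrite -covAS; apply: partitionU1.
have UAL B : B \in A |: L -> B \notin universal_classes G.
  move=> BAL; apply/imsetP => -[x xU eqB].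
  have := subsetP (partitionS partAL BAL) x.
  by rewrite eqB inE [x \in ~: _]inE xU eqxx => /(_ isT).
set P := universal_classes G :|: (A |: L).
have disj : [disjoint universal_classes G & A |: L].
  by rewrite disjoint_sym; apply/pred0P => B /=; apply/negP => /andP[/UAL/negP].
have partP : partition P [set: G].
  have /and3P[/eqP covL tiL L0] := partAL.
  have covU : cover (universal_classes G) = universal G.
    rewrite cover_imset; apply/setP => x.
    by apply/bigcupP/idP => [[y yU /set1P->]|xU] //; exists x; rewrite ?set11.
  apply/and3P; split.
  - by rewrite /cover bigcup_setU -!/(cover _) covL covU setUCr.
  - apply: trivIsetU => //; last by rewrite covU covL -setI_eq0 setICr.
    apply/trivIsetP => _ _ /imsetP[x _ ->] /imsetP[y _ ->] nxy.
    by rewrite disjoints1 inE; apply: contraNneq nxy => ->.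
  - rewrite inE negb_or L0 andbT; apply/imsetP => -[x _ /setP/(_ x)].
    by rewrite !inE eqxx.
have -> : #|universal G| + #|D|.+1 = #|P|.
  by rewrite cardsU (disjoint_setI0 disj) cards0 subn0
     card_universal_classes cardsU1 AL cardL.
apply: leq_IC; apply/(ic_partitionP partP) => B /setUP[BU|BAL].
  by left; rewrite -universal_classesP.
right; have {BAL} [->|/imsetP[X XD ->]] := setU1P BAL.
  have [s Ss] := set0Pn _ S0.
  have : s \in cover L by rewrite (cover_partition partL).
  case/bigcupP=> B' BL _; exists B'; first by rewrite !inE BL !orbT.
  case/imsetP: (BL) => X XD eqB; rewrite eqB indep_dominating_lift idD // andbT -eqB.
  by apply: contraNneq AL => <-.
exists A; first by rewrite !inE eqxx orbT.
rewrite setUC indep_dominating_lift idD // andbT.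
by apply: contraNneq AL => ->; apply: imset_f.
Qed.

End IsolatedClass.

(** * Building isomorphisms *)

(** [H] is the subgraph induced on [S], up to isomorphism. An embedding of [H]
    into [G] is used, rather than an isomorphism with [induced S], so that
    copies on disjoint sets can be glued without nesting subtypes. *)
Definition represents (G : sgraph) (S : {set G}) (H : sgraph) : Prop :=
  exists2 g : H -> G, injective g &
    (forall x y, adj (g x) (g y) = adj x y) /\ g @: [set: H] = S.

Lemma represents_isomorphic (G H : sgraph) :
  represents [set: G] H -> isomorphic G H.
Proof.
case=> g injg [adjg imgg].
have [|f fK gK] := inj_card_bij injg.
  by rewrite -[#|H|]cardsT -[#|G|]cardsT -imgg leq_imset_card.
exists f; first by exists g.
by move=> x y; rewrite -adjg !gK.
Qed.

Lemma isomorphic_refl (G : sgraph) : isomorphic G G.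
Proof. by exists id => //; exists id. Qed.

Lemma represents_induced (G : sgraph) (S : {set G}) : represents S (induced S).
Proof. by exists val; [exact: val_inj | split=> //; exact: lift_setT]. Qed.

(** [b = true] gives joins and [b = false] disjoint unions. *)
Lemma represents_sum (b : bool) (G H1 H2 : sgraph) (S1 S2 : {set G}) :
  represents S1 H1 -> represents S2 H2 -> [disjoint S1 & S2] ->
  (forall x y, x \in S1 -> y \in S2 -> adj x y = b) ->
  represents (S1 :|: S2) (SGraph (@sum_rel_sym b H1 H2) (@sum_rel_irrefl b H1 H2)).
Proof.
case=> g1 inj1 [adj1 im1] [g2 inj2 [adj2 im2]] d12 cross.
have g1S x : g1 x \in S1 by rewrite -im1 imset_f.
have g2S x : g2 x \in S2 by rewrite -im2 imset_f.
exists (fun u : H1 + H2 => match u with inl x => g1 x | inr y => g2 y end).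
  case=> x [] y /= eqxy.
  - by rewrite (inj1 _ _ eqxy).
  - by have := disjointFr d12 (g1S x); rewrite eqxy g2S.
  - by have := disjointFr d12 (g1S y); rewrite -eqxy g2S.
  - by rewrite (inj2 _ _ eqxy).
have cross12 x y : adj (g1 x) (g2 y) = b by rewrite cross.
split=> [[x|x] [y|y] /=|]; rewrite ?adj1 ?adj2 ?cross12 //.
  by rewrite adj_sym cross12.
apply/setP => z; apply/imsetP/setUP => [[[x|x] _ ->]|]; [by left|by right|].
by case; rewrite -?im1 -?im2 => /imsetP[x _ ->]; [exists (inl x)|exists (inr x)].
Qed.

Lemma enum_val_imset (T : finType) (S : {set T}) :
  [set enum_val i | i in [set: 'I_#|S|]] = S.
Proof.
apply/setP => x; apply/imsetP/idP => [[i _ ->]|Sx]; first exact: enum_valP.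
by exists (enum_rank_in Sx x); rewrite ?enum_rankK_in.
Qed.

Lemma represents_complete (G : sgraph) (S : {set G}) :
  {in S &, forall x y, x != y -> adj x y} -> represents S (complete #|S|).
Proof.
move=> adjS; exists (fun i : complete #|S| => enum_val i); first exact: enum_val_inj.
split=> [x y|]; last exact: enum_val_imset.
rewrite /= /complete_rel; have [->|nxy] := eqVneq x y; first by rewrite adj_irrefl.
by rewrite adjS ?enum_valP // (inj_eq enum_val_inj).
Qed.

Lemma represents_edgeless (G : sgraph) (S : {set G}) :
  independent S -> represents S (edgeless #|S|).
Proof.
move/independentP=> indS; exists (fun i : edgeless #|S| => enum_val i).
  exact: enum_val_inj.
split=> [x y|]; last exact: enum_val_imset.
by apply: negbTE; apply: indS; apply: enum_valP.
Qed.

Lemma represents_universal_join (G H : sgraph) :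
  represents (~: universal G) H -> isomorphic G (join (complete #|universal G|) H).
Proof.
move=> repH; apply: represents_isomorphic; rewrite -(setUCr (universal G)).
apply: (represents_sum (b := true)) => //.
- by apply: represents_complete => x y xU _; apply: universalP.
- by rewrite -setI_eq0 setICr.
- move=> x y xU; rewrite inE => yU; apply: universalP => //.
  by apply: contraNneq yU => <-.
Qed.

(** * The structure of the coalition relation *)

(** A graph with three or four vertices, none of them isolated, has a spanning
    star or a perfect matching. Fix an edge xy. If the remaining vertices are
    not joined to each other, all their neighbours are among x and y; either
    they share one, which is then the centre of a star, or they match x and y
    separately. *)
Lemma star_or_matching (T : finType) (r : rel T) (Q : {set T}) :
  symmetric r -> {in Q, forall x, exists2 y, y \in Q & (y != x) && r x y} ->
  #|Q| = 3 \/ #|Q| = 4 ->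
  (exists2 x, x \in Q & {in Q :\ x, forall y, r x y}) \/
  (exists x y z t, [/\ uniq [:: x; y; z; t], Q = [set x; y; z; t], r x y & r z t]).
Proof.
move=> symr mate cardQ.
have [x xQ] : exists x, x \in Q by apply/card_gt0P; case: cardQ => ->.
have [y yQ /andP[nyx rxy]] := mate x xQ.
pose R := Q :\ x :\ y.
have QE : Q = x |: (y |: R) by rewrite !setD1K // !inE nyx.
have cardR : #|Q| = #|R|.+2.
  by rewrite (cardsD1 x) xQ (cardsD1 y) !inE nyx yQ.
have [xR yR] : x \notin R /\ y \notin R by rewrite !inE !eqxx andbF.
clearbody R; case: cardQ; rewrite cardR => -[] /eqP.
  move=> /cards1P[z Rz]; left; subst R Q.
  have zQ : z \in x |: (y |: [set z]) by rewrite !inE eqxx !orbT.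
  have [w + /andP[nwz rzw]] := mate z zQ.
  rewrite !inE (negPf nwz) orbF => /orP[]/eqP eqw; subst w; rewrite symr in rzw.
  - exists x => // w; rewrite !inE => /andP[nwx]; rewrite (negPf nwx) /=.
    by case/orP=> /eqP->.
  - exists y => // w; rewrite !inE => /andP[nwy]; rewrite (negPf nwy) /=.
    by case/orP=> /eqP->; rewrite // symr.
move=> /cards2P[z [t [nzt Rzt]]]; subst R Q.
move: xR yR; rewrite !inE !negb_or => /andP[nxz nxt] /andP[nyz nyt].
pose S := x |: (y |: [set z; t]).
have zQ : z \in S by rewrite !inE eqxx !orbT.
have tQ : t \in S by rewrite !inE eqxx !orbT.
have uxyzt : uniq [:: x; y; z; t].
  by rewrite /= !inE !negb_or [x == y]eq_sym nyx nxz nxt nyz nyt nzt.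
have SE : S = [set x; y; z; t] by apply/setP => w; rewrite !inE -!orbA.
have perm_case a b c d : perm_eq [:: x; y; z; t] [:: a; b; c; d] ->
    r a b -> r c d -> (exists a b c d, [/\ uniq [:: a; b; c; d],
       S = [set a; b; c; d], r a b & r c d]).
  move=> pq rab rcd; exists a, b, c, d; split=> //; first by rewrite -(perm_uniq pq).
  apply/setP => w; move/perm_mem/(_ w): pq.
  by rewrite SE !inE -!orbA.
have [w + /andP[nwz rzw]] := mate z zQ; rewrite !inE (negPf nwz) /=.
have [v + /andP[nvt rtv]] := mate t tQ; rewrite !inE (negPf nvt) orbF.
rewrite orbA => vE wE.
have [rzt|nrzt] := boolP (r z t); first by right; apply: (perm_case x y z t).
move: wE vE; case/or3P=> /eqP eqw; subst w; last by rewrite rzw in nrzt.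
- case/orP=> [/orP[]|] /eqP eqv; subst v; last by rewrite symr rtv in nrzt.
  + left; exists x => // w; rewrite !inE => /andP[nwx]; rewrite (negPf nwx) /=.
    by case/or3P=> /eqP->; rewrite // symr.
  + right; apply: (perm_case z x t y) => //.
    apply/permP => p /=; rewrite !addn0 [RHS]addnCA; congr (_ + _).
    by rewrite addnC -addnA.
- case/orP=> [/orP[]|] /eqP eqv; subst v; last by rewrite symr rtv in nrzt.
  + right; apply: (perm_case z y t x) => //.
    apply/permP => p /=; rewrite !addn0 addnCA [RHS]addnCA; congr (_ + _).
    by rewrite addnC -addnA.
  + left; exists y => // w; rewrite !inE => /andP[nwx]; rewrite (negPf nwx) /=.
    by case/or3P=> /eqP->; rewrite // symr.
Qed.

(** Since [A :|: B] is independent for every other class [B], no edge leaves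
    [A] except to universal vertices, so the lemmas on isolated sets apply.
    The maximality of [IC G] enters as the upper bound on
    [idomatic_number H]. *)
Lemma star_induced (G : sgraph) (Q : {set {set G}}) (A : {set G}) :
  1 < #|Q|.-1 -> IC G = #|universal G| + #|Q| ->
  partition Q (~: universal G) -> A \in Q ->
  {in Q :\ A, forall B, indep_dominating (A :|: B)} ->
  exists (H : sgraph) (m : nat),
    [/\ 0 < #|H|, 1 <= m,
        [/\ multipartite H #|Q|.-1, 1 <= min_degree H & idomatic_number H = #|Q|.-1]
      & represents (~: universal G) (disjoint_union H (edgeless m))].
Proof.
move=> Q_gt1 ICE partQ AQ idQ; set R := Q :\ A; set S := ~: universal G :\: A.
have partR : partition R S by apply: partitionD1.
have cardR : #|R| = #|Q|.-1 by rewrite (cardsD1 A Q) AQ.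
have /card_gt0P[B0 B0R] : 0 < #|R| by rewrite cardR (ltn_trans _ Q_gt1).
have A0 : A != set0 by apply: partition_neq0 partQ AQ.
have S0 : S != set0.
  have /set0Pn[x Bx] := partition_neq0 partR B0R.
  by apply/set0Pn; exists x; apply: subsetP (partitionS partR B0R) x Bx.
have dAS : [disjoint A & S] by rewrite disjoint_sym disjoints_subset /S setDE subsetIr.
have covAS : A :|: S = ~: universal G.
  by rewrite /S setDE setUIr setUCr setIT; apply/setUidPr/(partitionS partQ).
have indAB B : B \in R -> independent (A :|: B) by case/idQ/andP.
have indA : independent A by apply: independentS (indAB B0 B0R); apply: subsetUl.
have noAS a s : a \in A -> s \in S -> ~~ adj a s.
  rewrite -(cover_partition partR) => Aa /bigcupP[B BR Bs].
  by apply: (independentP _ (indAB B BR) a s); rewrite inE ?Aa // Bs orbT.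
have [D idD cardD] := idomatic_partition_lift A0 dAS covAS indA noAS partR idQ.
have H_gt0 : 0 < #|induced S| by rewrite card_induced card_gt0.
rewrite cardR in cardD.
exists (induced S), #|A|; split=> //; first by rewrite card_gt0.
  split.
  - by rewrite -cardD; have [V] := idomatic_multipartite idD; exists V.
  - by apply: idomatic_min_degree idD _ => //; rewrite cardD.
  - apply/eqP; rewrite eqn_leq -{2}cardD leq_idomatic_number // andbT.
    apply/bigmax_leqP => E idE.
    have := idomatic_partition_leq_IC A0 S0 dAS covAS indA noAS idE.
    by rewrite ICE leq_add2l; case: #|Q| Q_gt1.
rewrite -covAS setUC; apply: (represents_sum (b := false)).
- exact: represents_induced.
- exact: represents_edgeless.
- by rewrite disjoint_sym.
- by move=> x y Sx Ay; apply: negbTE; rewrite adj_sym noAS.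
Qed.

(** The bound [id(G) <= 2] is [double_idomatic_leq_IC] with [IC G = 4]. *)
Lemma matching_B1 (G : sgraph) (X Y : {set G}) :
  0 < #|G| -> IC G = 4 -> universal G = set0 ->
  indep_dominating X -> indep_dominating Y -> [disjoint X & Y] ->
  X :|: Y = [set: G] -> family_B1 G.
Proof.
move=> G_gt0 ICE U0 idX idY dXY covXY.
have ID_gt1 (A : {set G}) : indep_dominating A -> 1 < #|A|.
  move=> idA; have A0 := indep_dominating_neq0 G_gt0 idA.
  rewrite ltn_neqAle card_gt0 A0 andbT; apply/eqP => /esym/eqP/cards1P[x eqA].
  have := in_set0 x; rewrite -U0 inE -eqA.
  by case/andP: idA => _ ->.
have X0 := indep_dominating_neq0 G_gt0 idX.
have Y0 := indep_dominating_neq0 G_gt0 idY.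
have partP : partition [set X; Y] [set: G].
  rewrite -covXY; apply: partitionU1 => //.
  by rewrite /partition /cover big_set1 eqxx trivIset1 inE eq_sym.
have idP : idomatic_partition [set X; Y].
  by rewrite /idomatic_partition partP; apply/forall_inP => A /set2P[]->.
have nXY : X != Y.
  by apply: contraNneq X0 => eqXY; move: dXY; rewrite -eqXY -setI_eq0 setIid.
have cardP : #|[set X; Y]| = 2 by rewrite cards2 nXY.
split.
- have := idomatic_multipartite idP; rewrite cardP => -[V partV VP].
  by exists V => // i; case/set2P: (VP i) => ->; apply: ID_gt1.
- by apply: idomatic_min_degree idP _; rewrite ?cardP.
- apply/eqP; rewrite eqn_leq -{2}cardP leq_idomatic_number // andbT.
  by rewrite -(@leq_pmul2r 2) // -[2 * 2]ICE double_idomatic_leq_IC.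
Qed.

Theorem proposition4p8 (G : sgraph) (hG : 0 < #|G|) (hIC : IC G = 4) :
  isomorphic G (complete 4)
  \/ (exists n : nat,
        2 <= n /\ isomorphic G (join (complete 2) (edgeless n)))
  \/ (exists B : sgraph,
        family_B2 B /\ isomorphic G (join (complete 1) B))
  \/ family_B1 G
  \/ family_B3 G.
Proof.
have [P icP cardP] := bigmax_witness (isT : 0 < 4) hIC.
have [Q [partQ cardUQ mateQ]] := ic_partition_split icP.
rewrite cardP in cardUQ.
have symr : symmetric (fun A B : {set G} => indep_dominating (A :|: B)).
  by move=> A B; rewrite setUC.
have ICE : IC G = #|universal G| + #|Q| by rewrite hIC.
have [Q0|[A AQ]] := set_0Vmem Q.
  left; rewrite Q0 cards0 addn0 in cardUQ.
  have UT : universal G = [set: G].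
    rewrite -[LHS]setCK -(cover_partition partQ) Q0 /cover big_set0.
    exact: setC0.
  rewrite UT in cardUQ; rewrite cardUQ.
  apply/represents_isomorphic/represents_complete => x y _ _.
  by apply: universalP; rewrite UT.
have [B BQ /andP[nBA idAB]] := mateQ A AQ.
have Q_ge2 : 1 < #|Q| by rewrite (cardsD1 A) AQ (cardsD1 B) !inE nBA BQ.
have Q_le4 : #|Q| <= 4 by rewrite cardUQ leq_addl.
have [Q2|Q_ge3] : #|Q| = 2 \/ 2 < #|Q|.
  by move: Q_ge2; rewrite leq_eqVlt => /orP[/eqP|]; [left|right].
  have U2 : 2 = #|universal G| by move: cardUQ; rewrite Q2 => -[]; rewrite addnC => -[].
  have QE : Q = [set A; B].
    apply/esym/eqP; rewrite eqEcard Q2 cards2 eq_sym nBA andbT.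
    by apply/subsetP => C /set2P[]->.
  have SE : ~: universal G = A :|: B.
    by rewrite -(cover_partition partQ) QE /cover bigcup_setU !big_set1.
  right; left; exists #|A :|: B|; split.
    have := card_partition partQ; rewrite SE => ->.
    rewrite -Q2 -sum1_card; apply: leq_sum => C CQ.
    by rewrite card_gt0 (partition_neq0 partQ CQ).
  rewrite {1}U2; apply: represents_universal_join; rewrite SE.
  by apply: represents_edgeless; case/andP: idAB.
have Q34 : #|Q| = 3 \/ #|Q| = 4.
  by move: Q_ge3 Q_le4; case: #|Q| => [|[|[|[|[|n]]]]] // _ _; [left|right].
have [[C CQ starC]|] := star_or_matching symr mateQ Q34.
  have [|H [m [H_gt0 m_gt0 famH repH]]] := star_induced _ ICE partQ CQ starC.
    by case: Q34 => ->.
  case: Q34 => Q34; rewrite Q34 in cardUQ famH.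
  - have U1 : 1 = #|universal G| by move: cardUQ; rewrite addnC => -[].
    right; right; left; exists (disjoint_union H (edgeless m)); split.
      by exists H, m; split=> //; apply: isomorphic_refl.
    by rewrite {1}U1; apply: represents_universal_join.
  - have U0 : universal G = set0.
      by apply: cards0_eq; move: cardUQ; rewrite addnC => -[].
    do 4!right; exists H, m; split=> //.
    by apply: represents_isomorphic; rewrite -setC0 -U0.
case=> W [X [Y [Z [uWXYZ QE rWX rYZ]]]].
have Q4 : #|Q| = 4 
  by rewrite -[RHS](card_uniqP uWXYZ) QE; apply: eq_card => C; rewrite !inE -!orbA.
have U0 : universal G = set0.
  by apply: cards0_eq; move: cardUQ; rewrite Q4 addnC => -[].
do 3!right; left; apply: (matching_B1 hG hIC U0 rWX rYZ).
  have inQ C : C \in [:: W; X; Y; Z] -> C \in Q by rewrite QE !inE -!orbA.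
  have dis := trivIsetP (partition_trivIset partQ).
  move: uWXYZ; rewrite /= !inE !negb_or -!andbA => /and5P[_ nWY nWZ nXY /andP[nXZ _]].
  have meet0 C D : C \in [:: W; X; Y; Z] -> D \in [:: W; X; Y; Z] -> C != D ->
      C :&: D = set0.
    by move=> CQ DQ nCD; apply/disjoint_setI0/dis => //; apply: inQ.
  by rewrite -setI_eq0 setIUl !setIUr !meet0 ?setU0 // !inE eqxx ?orbT.
rewrite -setC0 -U0 -(cover_partition partQ) QE /cover !bigcup_setU !big_set1.
by rewrite !setUA.
Qed.
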